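(* Every oriented matroid of rank $r\le 3$ is HK*.
   Context: Oriented matroids are given as $M=(E,\mathcal L)$ with $E$ a finite ground set and $\mathcal L\subseteq\{+,0,-\}^E$ the set of covectors (including $\mathbf 0$); $r(M)$ is the rank. For a sign vector $X$, $X^+,X^-,X^0$ are the sets of elements where $X$ is $+,-,0$, and $\underline X=X^+\cup X^-$. A coline of $M$ is a flat of rank $r(M)-2$. A coline fixation is a pair $\omega=(M,T)$ with $T\subset E$ a coline of $M$. Its supercell is $P_\omega=\{X\in\mathcal L: X_e\in\{0,+\}\text{ for all }e\in E\setminus T\}$. For $f\in E\setminus T$, the face induced by $f$ is $P_\omega(f)=\{X\in P_\omega: X_f=0\}$; the facets of $P_\omega$ are the inclusion-maximal sets among the $P_\omega(f)$. $T$ is generic in $M$ if for every $f\in E\setminus T$ there is $Y\in\mathcal L$ with $Y^0=T\cup\{f\}$ and $\underline Y=E\setminus(T\cup\{f\})$. The fixation $\omega$ is proper if $T$ is generic in $M$, there is $Z\in P_\omega$ with $Z^0=T$ and $Z^+=E\setminus T$, and all faces $P_\omega(f)$ ($f\in E\setminus T$) are facets. If $\omega$ is proper there is a linear ordering $e_1,\dots,e_s$ of $E\setminus T$, $s=|E\setminus T|$, unique up to reversal, such that for each $k$ the sign vector $V^k$ with $(V^k)^-=\{e_i:1\le i\le k-1\}$, $(V^k)^0=T\cup\{e_k\}$ (and $+$ elsewhere) is a cocircuit of $M$; it is called the coline shelling. The shelling digraph $SG_\omega$ has vertex set $\{e_1,\dots,e_s\}$ and an edge directed from $e_i$ to $e_j$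 if and only if $i<j$ and the facets $P_\omega(e_i),P_\omega(e_j)$ are adjacent, i.e. $P_\omega(e_i)\cap P_\omega(e_j)$ is inclusion-maximal among all intersections of two distinct facets. ($SG_\omega$ is acyclic with a unique source and a unique sink.) Holt-Klee condition in dimension $d$: a digraph with a unique source and a unique sink satisfies it if there are $d$ directed paths from the source to the sink that are pairwise internally vertex-disjoint. A proper coline fixation $\omega=(M,T)$ is HK* if $SG_\omega$ satisfies the Holt-Klee condition in dimension $d=r(M)-1$. An oriented matroid $M$ is HK* if for every oriented matroid $N$ obtained from $M$ by reorientation and taking minors (including $M$ itself) and every coline $T$ of $N$ such that $(N,T)$ is proper, $(N,T)$ is HK* (with $d=r(N)-1$).
   Formalization: The d directed paths in the Holt-Klee condition may coincide when they are the single edge from source to sink; with distinct paths the claim fails for three independent elements in rank 3 with T one of them (one edge, d=2). *)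

(* Defs.v *)
From HB Require Import structures.
From mathcomp Require Import all_boot.

Set Implicit Arguments.
Unset Strict Implicit.
Unset Printing Implicit Defensive.

Inductive sign := Neg | Zero | Pos.

Definition sign_code (a : sign) : option bool :=
  match a with Neg => Some false | Zero => None | Pos => Some true end.

Definition sign_decode (c : option bool) : sign :=
  match c with Some false => Neg | None => Zero | Some true => Pos end.

Lemma sign_codeK : cancel sign_code sign_decode. Proof. by case. Qed.

HB.instance Definition _ := Finite.copy sign (can_type sign_codeK).

Definition sopp (a : sign) : sign :=
  match a with Neg => Pos | Zero => Zero | Pos => Neg end.

Section SignVectors.
Variable U : finType.

Definition svec := {ffun U -> sign}.

Implicit Types (X Y : svec) (A : {set U}).

Definition supp X : {set U} := [set e | X e != Zero].

Definition svec0 : svec := [ffun=> Zero].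

Definition vopp X : svec := [ffun e => sopp (X e)].

Definition vcomp X Y : svec := [ffun e => if X e == Zero then Y e else X e].

Definition separation X Y : {set U} :=
  [set e | (X e != Zero) && (X e == sopp (Y e))].

Definition vreorient A X : svec :=
  [ffun e => if e \in A then sopp (X e) else X e].

Definition verase A X : svec := [ffun e => if e \in A then Zero else X e].

(* The ground set E is a subset of a fixed finite type U, so that minors of an *)
(* oriented matroid live over the same type.  An element of {+,0,-}^E is       *)
(* encoded as its extension by Zero to U (first clause).                       *)
Record covector_axioms (E : {set U}) (L : {set svec}) : Prop := CovectorAxioms {
  cov_supp : forall X, X \in L -> supp X \subset E;
  cov_zero : svec0 \in L;
  cov_opp : forall X, X \in L -> vopp X \in L;
  cov_comp : forall X Y, X \in L -> Y \in L -> vcomp X Y \in L;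
  cov_elim : forall X Y e, X \in L -> Y \in L -> e \in separation X Y ->
    exists Z, [/\ Z \in L, Z e = Zero &
      forall f, f \notin separation X Y -> Z f = vcomp X Y f]
}.

Record oriented_matroid := OrientedMatroid {
  ground : {set U};
  covectors : {set svec};
  covectorsP : covector_axioms ground covectors
}.

Implicit Types M N : oriented_matroid.

Definition zero_set M X : {set U} := [set e in ground M | X e == Zero].

Definition cocircuit M X : bool :=
  [&& X \in covectors M, X != svec0 &
    [forall (Y | (Y \in covectors M) && (Y != svec0)),
      (supp Y \subset supp X) ==> (supp Y == supp X)]].

Definition flat M A : bool := [exists X in covectors M, A == zero_set M X].

Definition closure M A : {set U} := \bigcap_(F | flat M F && (A \subset F)) F.

Definition independent M A : bool :=
  (A \subset ground M) && [forall e in A, e \notin closure M (A :\ e)].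

Definition rank_of M A : nat :=
  \max_(I : {set U} | (I \subset A) && independent M I) #|I|.

Definition rank M : nat := rank_of M (ground M).

Lemma soppK : involutive sopp. Proof. by case. Qed.

Lemma sopp_eq0 a : (sopp a == Zero) = (a == Zero). Proof. by case: a. Qed.

Lemma vreorient_separation A X Y :
  separation (vreorient A X) (vreorient A Y) = separation X Y.
Proof.
apply/setP=> e; rewrite !inE !ffunE.
by case: (e \in A) => //; case: (X e); case: (Y e).
Qed.

Lemma vreorient_comp A X Y :
  vcomp (vreorient A X) (vreorient A Y) = vreorient A (vcomp X Y).
Proof.
by apply/ffunP=> e; rewrite !ffunE; case: (e \in A); case: (X e); case: (Y e).
Qed.

Lemma reorientation_subproof M A :
  covector_axioms (ground M) [set vreorient A X | X in covectors M].
Proof.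
have [sL L0 LN LC LE] := covectorsP M; split.
- move=> _ /imsetP[X XL ->]; apply: subset_trans (sL X XL).
  by apply/subsetP=> e; rewrite !inE !ffunE; case: ifP; rewrite ?sopp_eq0.
- by apply/imsetP; exists svec0 => //; apply/ffunP=> e; rewrite !ffunE if_same.
- move=> _ /imsetP[X XL ->]; apply/imsetP; exists (vopp X); first exact: LN.
  by apply/ffunP=> e; rewrite !ffunE; case: ifP.
- move=> _ _ /imsetP[X XL ->] /imsetP[Y YL ->]; apply/imsetP.
  by exists (vcomp X Y); [exact: LC | rewrite vreorient_comp].
move=> _ _ e /imsetP[X XL ->] /imsetP[Y YL ->].
rewrite vreorient_separation => /(LE _ _ _ XL YL)[Z [ZL Ze ZE]].
exists (vreorient A Z); split; first exact: imset_f.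
  by rewrite ffunE Ze if_same.
by move=> f /ZE Zf; rewrite vreorient_comp [LHS]ffunE [RHS]ffunE Zf.
Qed.

Definition reorientation M A : oriented_matroid :=
  OrientedMatroid (reorientation_subproof M A).

Lemma deletion_subproof M A :
  covector_axioms (ground M :\: A) [set verase A X | X in covectors M].
Proof.
have [sL L0 LN LC LE] := covectorsP M; split.
- move=> _ /imsetP[X XL ->]; apply/subsetP=> e; rewrite !inE !ffunE.
  case: ifP => //= _ Xe; apply: (subsetP (sL X XL)); by rewrite inE.
- by apply/imsetP; exists svec0 => //; apply/ffunP=> e; rewrite !ffunE if_same.
- move=> _ /imsetP[X XL ->]; apply/imsetP; exists (vopp X); first exact: LN.
  by apply/ffunP=> e; rewrite !ffunE; case: ifP.
- move=> _ _ /imsetP[X XL ->] /imsetP[Y YL ->]; apply/imsetP.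
  exists (vcomp X Y); first exact: LC.
  by apply/ffunP=> e; rewrite !ffunE; case: (e \in A).
move=> _ _ e /imsetP[X XL ->] /imsetP[Y YL ->] eS.
have eS' : e \in separation X Y.
  by move: eS; rewrite !inE !ffunE; case: (e \in A).
have [Z [ZL Ze ZE]] := LE _ _ _ XL YL eS'.
exists (verase A Z); split; first exact: imset_f.
  by rewrite ffunE Ze if_same.
move=> f; rewrite !inE !ffunE; case: ifP => // fA fS.
by rewrite ZE ?inE // ffunE.
Qed.

Definition deletion M A : oriented_matroid :=
  OrientedMatroid (deletion_subproof M A).

Lemma contraction_subproof M A :
  covector_axioms (ground M :\: A)
    [set X in covectors M | [forall e in A, X e == Zero]].
Proof.
have [sL L0 LN LC LE] := covectorsP M; split.
- move=> X; rewrite inE => /andP[XL /forall_inP XA]; apply/subsetP=> e eX.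
  rewrite inE (subsetP (sL X XL) _ eX) andbT.
  by apply/negP=> /XA; move: eX; rewrite inE => /negP.
- by rewrite inE L0; apply/forall_inP=> e _; rewrite ffunE.
- move=> X; rewrite !inE => /andP[/LN-> /forall_inP XA].
  by apply/forall_inP=> e /XA; rewrite ffunE sopp_eq0.
- move=> X Y; rewrite !inE => /andP[XL /forall_inP XA] /andP[YL /forall_inP YA].
  rewrite LC //=; apply/forall_inP=> e eA.
  by rewrite ffunE XA // YA.
move=> X Y e; rewrite !inE => /andP[XL /forall_inP XA] /andP[YL /forall_inP YA].
move=> eS; have eS' : e \in separation X Y by rewrite inE.
have [Z [ZL Ze ZE]] := LE _ _ _ XL YL eS'.
exists Z; split=> //; rewrite inE ZL; apply/forall_inP=> f fA.
by rewrite ZE ?inE ?ffunE XA // YA.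
Qed.

Definition contraction M A : oriented_matroid :=
  OrientedMatroid (contraction_subproof M A).

Inductive reorientation_minor M : oriented_matroid -> Prop :=
| RM_refl : reorientation_minor M M
| RM_reorientation N A :
    reorientation_minor M N -> reorientation_minor M (reorientation N A)
| RM_deletion N A :
    reorientation_minor M N -> reorientation_minor M (deletion N A)
| RM_contraction N A :
    reorientation_minor M N -> reorientation_minor M (contraction N A).

Implicit Type T : {set U}.

Definition coline M T : bool := flat M T && (rank_of M T + 2 == rank M).

Definition supercell M T : {set svec} :=
  [set X in covectors M |
    [forall e in ground M :\: T, (X e == Zero) || (X e == Pos)]].

Definition face M T (f : U) : {set svec} :=
  [set X in supercell M T | X f == Zero].

Definition faces M T : {set {set svec}} :=
  [set face M T f | f in ground M :\: T].

Definition facets M T : {set {set svec}} :=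
  [set F | maxset (fun G => G \in faces M T) F].

Definition generic M T : bool :=
  [forall f in ground M :\: T, [exists Y in covectors M,
    (zero_set M Y == f |: T) && (supp Y == ground M :\: (f |: T))]].

Definition proper M T : bool :=
  [&& generic M T,
      [exists Z in supercell M T, (zero_set M Z == T) &&
        ([set e | Z e == Pos] == ground M :\: T)] &
      [forall f in ground M :\: T, face M T f \in facets M T]].

(* For s = [:: e_1; ...; e_s], the vector V^k with e_k = f: zero on T and at f, *)
(* Neg on the elements listed before f, Pos on those listed after f.            *)
Definition shelling_vector (s : seq U) (f : U) : svec :=
  [ffun e => if (e \notin s) || (e == f) then Zero
             else if index e s < index f s then Neg else Pos].

Definition coline_shelling M T (s : seq U) : Prop :=
  perm_eq s (enum (ground M :\: T)) /\
  forall f, f \in s -> cocircuit M (shelling_vector s f).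

Definition facet_intersections M T : {set {set svec}} :=
  [set F :&: G | F in facets M T, G in facets M T & F != G].

Definition adjacent M T (e f : U) : bool :=
  maxset (fun I => I \in facet_intersections M T) (face M T e :&: face M T f).

Definition shelling_edge M T (s : seq U) : rel U := fun e f =>
  [&& e \in s, f \in s, index e s < index f s & adjacent M T e f].

End SignVectors.

Section Digraphs.
Variables (V : finType) (D : {set V}) (edge : rel V).

Definition is_source x : bool := (x \in D) && [forall y in D, ~~ edge y x].

Definition is_sink x : bool := (x \in D) && [forall y in D, ~~ edge x y].

Definition dipath x y (p : seq V) : bool :=
  [&& path edge x p, last x p == y & uniq (x :: p)].

Definition internal x (p : seq V) : seq V := behead (belast x p).

(* The d paths form a family indexed by 'I_d whose members are required to be *)
(* internally disjoint, not a priori distinct; so a path without internal     *)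
(* vertices may occur more than once.  This matters in small cases: for three *)
(* independent elements and T one of them, the shelling digraph is a single   *)
(* edge, while d = 2.                                                         *)
Definition holt_klee (d : nat) : Prop :=
  exists x y : V,
    [/\ forall z, is_source z = (z == x),
        forall z, is_sink z = (z == y) &
        exists p : 'I_d -> seq V,
          (forall i, dipath x y (p i)) /\
          (forall i j, i != j ->
             forall z, z \in internal x (p i) -> z \notin internal x (p j))].

End Digraphs.

(* A coline shelling of a proper fixation exists and is unique up to reversal; *)
(* existence is stated so that the condition cannot hold vacuously.            *)
Definition fixation_HKstar (U : finType) (M : oriented_matroid U)
    (T : {set U}) : Prop :=
  (exists s, coline_shelling M T s) /\
  forall s, coline_shelling M T s ->
    holt_klee (ground M :\: T) (shelling_edge M T s) (rank M).-1.

Definition HKstar (U : finType) (M : oriented_matroid U) : Prop :=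
  forall N, reorientation_minor M N ->
  forall T, coline N T -> proper N T -> fixation_HKstar N T.

(* Main.v *)
Require Import Defs.
From mathcomp Require Import all_boot.
(* [closure] and [proper] denote the notions of oriented matroids again *)
Import Defs.

Set Implicit Arguments.
Unset Strict Implicit.
Unset Printing Implicit Defensive.

(** Reorientations and minors do not increase the rank
    ([reorientation_minor_rank]), and a coline exists only in rank at least two,
    so only proper fixations [(M, T)] of rank two or three are concerned. Write
    [S] for the complement of [T] in the ground set.

    The contraction of [T] has rank two, so each [f] in [S] carries a single pair
    of opposite covectors that vanish on [T] and at [f] ([pencil_unique]). Their
    signs order [S] linearly, and this order is a coline shelling
    ([coline_shelling_exists]). Below, [V f] is the cocircuit of a given shelling
    at [f].

    In rank two the only nonzero points of the faces are the covectors [V f] and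
    their opposites. The one for [f] is in the supercell only if [f] is first or
    last, so [S] has two elements and the digraph is a single edge.

    In rank three, regard the elements of [S] as pseudolines and [T] as the line
    at infinity, with [t] a nonloop of [T]. On each side of [T] the supercell is
    the region beyond an envelope of the arrangement, and the shelling sorts the
    pseudolines by slope. Suppose that the pseudoline [i] touches the envelope on
    one side. Walk along it from a point of the supercell towards its crossings
    with the later elements; the first crossing met still belongs to the
    supercell ([next_crossing]). That crossing is a common vertex of two facets,
    hence an edge of the digraph ([crossing_adjacent]). So the walk on either side
    goes from the first element to the last one. The same argument in the
    direction of the earlier elements shows that only the first element is a
    source. All that the argument uses about two points of a pseudoline on the
    same side of [T] is that elimination of [t] turns their difference into a
    multiple of [V i] ([line_difference]).

    An element other than the first and the last touches only one of the two
    envelopes ([inner_envelope_disjoint]): otherwise its face would be contained in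
    the face of the first element, against maximality. The two walks are
    therefore internally disjoint. *)

(** * Covectors, independence and rank *)

Section Matroid.
Variable U : finType.
Implicit Types (M N : oriented_matroid U) (A I T : {set U}) (X Y W : svec U).

Lemma cov_out M X e : X \in covectors M -> e \notin ground M -> X e = Zero.
Proof.
move=> XL; apply: contraNeq => Xe.
by apply: (subsetP (cov_supp (covectorsP M) XL)); rewrite inE.
Qed.

Lemma svec_neq0P X : reflect (exists e, X e != Zero) (X != svec0 U).
Proof.
apply: (iffP idP) => [X0 | [e]]; last by apply: contraNneq => ->; rewrite ffunE.
apply/existsP; apply: contraT; rewrite negb_exists => /forallP nX.
case/eqP: X0; apply/ffunP=> e; rewrite ffunE; apply/eqP.
by have := nX e; rewrite negbK.
Qed.

(** Covector elimination in evaluated form: away from the separation set the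
    result is the composition of [X] and [Y]. *)
Lemma cov_eliminate M X Y e :
  X \in covectors M -> Y \in covectors M -> X e != Zero -> Y e = sopp (X e) ->
  exists Z, [/\ Z \in covectors M, Z e = Zero &
    forall f, ~~ ((X f != Zero) && (X f == sopp (Y f))) ->
      Z f = if X f == Zero then Y f else X f].
Proof.
move=> XL YL Xe Ye; have eS : e \in separation X Y.
  by rewrite inE Xe Ye soppK eqxx.
have [Z [ZL Ze ZE]] := cov_elim (covectorsP M) XL YL eS.
by exists Z; split=> // f fS; rewrite ZE ?inE // ffunE.
Qed.

(** Elimination as a pivot: a covector [Y] that does not vanish at [e] makes [X]
    vanish at [e] without changing [X] on the zero set of [Y]. *)
Lemma cov_pivot M X Y e :
  X \in covectors M -> Y \in covectors M -> Y e != Zero ->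
  exists Z, [/\ Z \in covectors M, Z e = Zero &
    forall f, Y f = Zero -> Z f = X f].
Proof.
move=> XL YL Ye; have [Xe | Xe] := eqVneq (X e) Zero; first by exists X.
have [Y' [Y'L Y'e Y'0]] : exists Y', [/\ Y' \in covectors M, Y' e = sopp (X e) &
    forall f, Y f = Zero -> Y' f = Zero].
  have [Ye' | Ye'] := eqVneq (Y e) (sopp (X e)); first by exists Y.
  exists (vopp Y); split; first exact: (cov_opp (covectorsP M)).
    by rewrite ffunE; case: (X e) (Y e) Xe Ye Ye' => [] [].
  by move=> f Yf; rewrite ffunE Yf.
have [Z [ZL Ze ZE]] := cov_eliminate XL Y'L Xe Y'e.
exists Z; split=> // f /Y'0 Y'f.
by rewrite ZE Y'f; case: (X f).
Qed.

Lemma notin_closureP M A e : A \subset ground M -> e \in ground M ->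
  reflect (exists X, [/\ X \in covectors M, {in A, forall a, X a = Zero} &
                         X e != Zero])
          (e \notin closure M A).
Proof.
move=> AE eE; apply: (iffP idP) => [eC | [X [XL XA Xe]]].
  have : [exists X in covectors M, (A \subset zero_set M X) && (X e != Zero)].
    apply: contraNT eC => nX; apply/bigcapP=> F /andP[/exists_inP[X XL /eqP->] AX].
    rewrite inE eE /=; apply: contraNT nX => Xe.
    by apply/exists_inP; exists X; rewrite // AX.
  case/exists_inP=> X XL /andP[/subsetP XA Xe]; exists X; split=> // a /XA.
  by rewrite inE => /andP[_ /eqP].
apply/negP => /bigcapP/(_ (zero_set M X)); rewrite inE eE (negPf Xe) => H.
suff: false by []; apply: H; apply/andP; split.
  by apply/exists_inP; exists X.
by apply/subsetP=> a aA; rewrite inE (subsetP AE) // XA.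
Qed.

(** A set is independent when it carries a diagonal family of covectors: each
    element has a covector that vanishes at all the others but not at it. *)
Lemma independentP M I :
  reflect (I \subset ground M /\ forall a, a \in I ->
             exists X, [/\ X \in covectors M, X a != Zero &
                           forall b, b \in I -> b != a -> X b = Zero])
          (independent M I).
Proof.
have sD a : I \subset ground M -> I :\ a \subset ground M.
  by apply: subset_trans; exact: subsetDl.
apply: (iffP andP) => [[IE /forall_inP dI] | [IE dI]]; split=> //.
  move=> a aI; have /(notin_closureP (sD a IE) (subsetP IE a aI)) := dI a aI.
  case=> X [XL XI Xa]; exists X; split=> // b bI ba.
  by apply: XI; rewrite !inE ba.
apply/forall_inP=> a aI; have [X [XL Xa XI]] := dI a aI.
apply/(notin_closureP (sD a IE) (subsetP IE a aI)); exists X; split=> // b.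
by rewrite !inE => /andP[ba bI]; exact: XI.
Qed.

Lemma independentU1 M I X e : independent M I -> X \in covectors M ->
  {in I, forall a, X a = Zero} -> X e != Zero -> independent M (e |: I).
Proof.
move=> /independentP[IE dI] XL XI Xe; apply/independentP; split.
  rewrite subUset IE sub1set andbT.
  by apply: contraNT Xe => /(cov_out XL)->.
move=> a; rewrite !inE => /orP[/eqP-> | aI].
  exists X; split=> // b; rewrite !inE => /orP[/eqP->|]; first by rewrite eqxx.
  by move=> /XI.
have [Y [YL Ya YI]] := dI a aI; have [Z [ZL Ze ZX]] := cov_pivot YL XL Xe.
exists Z; split=> //; first by rewrite ZX ?XI.
move=> b; rewrite !inE => /orP[/eqP-> // | bI] ba.
by rewrite ZX ?XI // YI.
Qed.

Lemma independent_rank M I : independent M I -> #|I| <= rank M.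
Proof.
move=> dI; rewrite /rank /rank_of; apply: leq_bigmax_cond.
by rewrite dI andbT; case/andP: dI.
Qed.

Lemma rank_of_basis M A :
  exists I, [/\ I \subset A, independent M I & #|I| = rank_of M A].
Proof.
have d0 : (set0 \subset A) && independent M set0.
  by rewrite sub0set /independent sub0set; apply/forall_inP=> e; rewrite inE.
rewrite /rank_of (@bigmax_eq_arg _ set0 (fun I => (I \subset A) && independent M I)) //.
by case: arg_maxnP => // I /andP[IA dI] _; exists I.
Qed.

(** Each vanishing condition costs at most one dimension: requiring the diagonal
    covectors of [I] to vanish along [l] leaves at least [#|I| - size l] of them,
    because one of them can serve as the pivot for each element of [l]. *)
Lemma diagonal_vanishing M (l : seq U) I : independent M I ->
  exists J : {set U}, [/\ J \subset I, #|I| <= #|J| + size l &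
    forall a, a \in J -> exists X, [/\ X \in covectors M, X a != Zero,
      forall b, b \in J -> b != a -> X b = Zero &
      forall b, b \in l -> X b = Zero]].
Proof.
move=> dI; elim: l => [|e l [J [JI cJ dJ]]].
  have /independentP[_ {}dI] := dI; exists I; split=> //; first by rewrite addn0.
  by move=> a /dI[X [XL Xa XI]]; exists X; split.
have [/existsP[p] | nE] := boolP [exists p, [exists X in covectors M,
    [&& p \in J, X p != Zero, X e != Zero,
      [forall b in J, (b != p) ==> (X b == Zero)] & all (fun b => X b == Zero) l]]].
  case/exists_inP=> X XL /and5P[pJ Xp Xe /forall_inP XJ /allP Xl].
  exists (J :\ p); split.
  - by apply: subset_trans JI; exact: subsetDl.
  - by rewrite /= addnS -addSn; move: cJ; rewrite (cardsD1 p J) pJ.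
  move=> a; rewrite !inE => /andP[ap aJ].
  have [Y [YL Ya YJ Yl]] := dJ a aJ; have [Z [ZL Ze ZX]] := cov_pivot YL XL Xe.
  have XJ0 b : b \in J -> b != p -> X b = Zero.
    by move=> bJ bp; apply/eqP; exact: (implyP (XJ b bJ)).
  exists Z; split=> //; first by rewrite ZX ?XJ0.
    by move=> b; rewrite !inE => /andP[bp bJ] ba; rewrite ZX ?XJ0 // YJ.
  move=> b; rewrite inE => /orP[/eqP-> // | bl].
  by rewrite ZX ?Yl //; apply/eqP; exact: Xl.
exists J; split=> //; first by rewrite (leq_trans cJ) //= addnS leqnSn.
move=> a aJ; have [X [XL Xa XJ Xl]] := dJ a aJ; exists X; split=> // b.
rewrite inE => /orP[/eqP-> | /Xl //]; apply/eqP; apply: contraNT nE => Xe.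
apply/existsP; exists a; apply/exists_inP; exists X => //; apply/and5P; split=> //.
  by apply/forall_inP=> c ?; apply/implyP=> ca; rewrite XJ.
by apply/allP=> c cl; rewrite Xl.
Qed.

Lemma exists_vanish_lt_rank M A : #|A| < rank M ->
  exists X, [/\ X \in covectors M, X != svec0 U & {in A, forall a, X a = Zero}].
Proof.
rewrite /rank; have [I [_ dI <-]] := rank_of_basis M (ground M).
have [J [_ cJ dJ]] := diagonal_vanishing (enum A) dI.
rewrite -cardE in cJ => cA.
have /card_gt0P[a /dJ[X [XL Xa _ XA]]] : 0 < #|J|.
  by rewrite lt0n; apply: contraTneq cA => J0; rewrite -leqNgt (leq_trans cJ) // J0.
exists X; split=> //; first by apply/svec_neq0P; exists a.
by move=> b bA; apply: XA; rewrite mem_enum.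
Qed.

(** A flat of corank one carries a single pair of opposite covectors; a further
    covector would extend [I] to an independent set of size [#|I| + 2]. *)
Lemma corank1_unique M I X Y : independent M I -> rank M <= #|I|.+1 ->
  X \in covectors M -> {in I, forall a, X a = Zero} -> X != svec0 U ->
  Y \in covectors M -> {in I, forall a, Y a = Zero} ->
  [\/ Y = svec0 U, Y = X | Y = vopp X].
Proof.
move=> dI rI XL XI X0 YL YI.
have key W V h g : W \in covectors M -> {in I, forall a, W a = Zero} ->
    V \in covectors M -> {in I, forall a, V a = Zero} ->
    W h != Zero -> V h = Zero -> V g != Zero -> False.
  move=> WL WI VL VI Wh Vh Vg.
  have dh := independentU1 dI WL WI Wh.
  have dg : independent M (g |: (h |: I)).
    apply: (independentU1 dh VL) Vg => a; rewrite !inE => /orP[/eqP->//|]; exact: VI.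
  have := leq_trans (independent_rank dg) rI.
  have hI : h \notin I by apply: contraNN Wh => /WI->.
  have gI : g \notin h |: I.
    by rewrite !inE; apply: contraNN Vg => /orP[/eqP->|/VI->//]; rewrite Vh.
  by rewrite !cardsU1 hI gI !add1n ltnn.
have [-> | Y0] := eqVneq Y (svec0 U); first by constructor 1.
have [-> | YX] := eqVneq Y X; first by constructor 2.
have [-> | YX'] := eqVneq Y (vopp X); first by constructor 3.
have /svec_neq0P[x Xx] := X0; have /svec_neq0P[y Yy] := Y0.
have XY0 h : (X h == Zero) = (Y h == Zero).
  apply/idP/idP=> /eqP h0; apply: contraT => hn; exfalso.
    exact: (key Y X h x).
  exact: (key X Y h y).
(* X and Y have the same support, agree at some g and differ at some h, where
   they are opposite; eliminating h yields a covector of smaller support *)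
have [h] : exists h, Y h != X h.
  apply/existsP; apply: contraT; rewrite negb_exists => /forallP nE.
  by case/eqP: YX; apply/ffunP=> h; apply/eqP; have := nE h; rewrite negbK.
have [g] : exists g, Y g != sopp (X g).
  apply/existsP; apply: contraT; rewrite negb_exists => /forallP nE.
  case/eqP: YX'; apply/ffunP=> h'; rewrite ffunE.
  by apply/eqP; have := nE h'; rewrite negbK.
move=> Yg Yh; have Xh : X h != Zero.
  by apply: contraNN Yh => Xh; move: (Xh); rewrite XY0 => /eqP->; rewrite eq_sym.
have Yh' : Y h = sopp (X h).
  by have := XY0 h; case: (X h) (Y h) Xh Yh => [] [].
have [W [WL Wh WE]] := cov_eliminate XL YL Xh Yh'.
exfalso; apply: (key X W h g) => //.
  by move=> a aI; rewrite WE XI // YI.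
have := XY0 g; rewrite WE; first by case: (X g) (Y g) Yg => [] [].
by case: (X g) (Y g) Yg => [] [].
Qed.

Lemma leq_rank M N :
  (forall I, independent N I -> independent M I) -> rank N <= rank M.
Proof.
move=> sub; rewrite {1}/rank; have [I [_ dI <-]] := rank_of_basis N (ground N).
exact/independent_rank/sub.
Qed.

Lemma reorientation_minor_rank M N : reorientation_minor M N -> rank N <= rank M.
Proof.
elim=> {N} [//|N A _|N A _|N A _] le; apply: leq_trans le; apply: leq_rank => I.
- move=> /independentP[IE dI]; apply/independentP; split=> // a /dI.
  case=> _ [/imsetP[X XL ->] Xa XI]; exists X; split=> // [|b bI ba].
    by move: Xa; rewrite ffunE; case: ifP; rewrite ?sopp_eq0.
  have := XI b bI ba; rewrite ffunE; case: ifP => // _ /eqP.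
  by rewrite sopp_eq0 => /eqP.
- move=> /independentP[/subsetDP[IE IA] dI]; apply/independentP; split=> // a aI.
  case: (dI a aI) => _ [/imsetP[X XL ->] Xa XI].
  have nA b : b \in I -> b \in A = false by apply: disjointFr.
  exists X; split=> // [|b bI ba]; first by move: Xa; rewrite ffunE nA.
  by have := XI b bI ba; rewrite ffunE nA.
move=> /independentP[/subsetDP[IE _] dI]; apply/independentP; split=> // a /dI.
by case=> X []; rewrite inE => /andP[XL _] Xa XI; exists X.
Qed.

End Matroid.

(** * The pencil of a coline and the existence of its shelling *)

Section Fixation.
Variables (U : finType) (M : oriented_matroid U) (T : {set U}).
Hypotheses (colineT : coline M T) (properT : proper M T).
Implicit Types (I : {set U}) (X Y W : svec U) (e f g : U).
Local Notation E := (ground M).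
Local Notation S := (ground M :\: T).

Lemma coline_basis :
  exists I, [/\ I \subset T, independent M I & #|I| + 2 = rank M].
Proof.
have [I [IT dI cI]] := rank_of_basis M T; exists I; split=> //.
by rewrite cI; case/andP: colineT => _ /eqP.
Qed.

Lemma basis_vanish I W : I \subset T -> independent M I -> #|I| + 2 = rank M ->
  W \in covectors M -> {in I, forall a, W a = Zero} -> {in T, forall a, W a = Zero}.
Proof.
move=> IT dI cI WL WI a aT; apply/eqP; apply: contraT => Wa.
have dJ := independentU1 dI WL WI Wa.
have aI : a \notin I by apply: contraNN Wa => /WI->.
have : #|a |: I| <= rank_of M T.
  by apply: leq_bigmax_cond; rewrite dJ subUset sub1set aT IT.
have /andP[_ /eqP rT] := colineT.
by rewrite cardsU1 aI add1n -(leq_add2r 2) rT -cI addSn ltnn.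
Qed.

Lemma proper_interior : exists Z, [/\ Z \in covectors M,
  {in T, forall a, Z a = Zero} & {in S, forall a, Z a = Pos}].
Proof.
have /and3P[_ /exists_inP[Z] ] := properT.
rewrite inE => /andP[ZL _] /andP[/eqP Z0 /eqP Zp] _; exists Z; split=> // a.
  by rewrite -Z0 inE => /andP[_ /eqP].
by rewrite -Zp inE => /eqP.
Qed.

Lemma cov_vanish_eq0 f X : f \in S -> X \in covectors M ->
  {in f |: T, forall a, X a = Zero} -> {in S :\ f, forall a, X a = Zero} ->
  X = svec0 U.
Proof.
move=> fS XL XT XS; apply/ffunP=> a; rewrite ffunE.
have [aT | aT] := boolP (a \in f |: T); first exact: XT.
have [aE | aE] := boolP (a \in E); last exact: (cov_out XL).
by apply: XS; move: aT; rewrite !inE negb_or aE andbT.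
Qed.

(** The contraction of [T] has rank two: each element [f] off the coline carries
    one pair of opposite covectors that vanish on [T] and at [f]. *)
Lemma pencil_unique f X Y : f \in S ->
  X \in covectors M -> {in f |: T, forall a, X a = Zero} -> X != svec0 U ->
  Y \in covectors M -> {in f |: T, forall a, Y a = Zero} ->
  [\/ Y = svec0 U, Y = X | Y = vopp X].
Proof.
move=> fS XL X0 Xn YL Y0; have [I [IT dI cI]] := coline_basis.
have [Z [ZL ZT Zp]] := proper_interior.
have dJ : independent M (f |: I).
  by apply: (independentU1 dI ZL) => [a /(subsetP IT)/ZT // |]; rewrite Zp.
have sub : f |: I \subset f |: T by rewrite setUS.
apply: (corank1_unique dJ _ XL _ Xn YL).
- have fI : f \notin I by apply/negP => /(subsetP IT); case/setDP: fS => _ /negP.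
  by rewrite cardsU1 fI -cI addn2.
- by move=> a /(subsetP sub); exact: X0.
by move=> a /(subsetP sub); exact: Y0.
Qed.

Lemma pencil_generic f : f \in S -> exists Y, [/\ Y \in covectors M,
  {in f |: T, forall a, Y a = Zero}, {in S :\ f, forall a, Y a != Zero} &
  Y != svec0 U].
Proof.
move=> fS; have /and3P[/forall_inP/(_ f fS)/exists_inP[Y YL] + _ _] := properT.
move=> /andP[/eqP Y0 /eqP Yn]; exists Y.
have YS : {in S :\ f, forall a, Y a != Zero}.
  move=> a; rewrite !inE => /and3P[af aT aE].
  have: a \in supp Y by rewrite Yn !inE negb_or af aT aE.
  by rewrite inE.
split=> // [a|]; first by rewrite -Y0 inE => /andP[_ /eqP].
have [I [IT dI cI]] := coline_basis.
have [|X [XL Xn XI]] := @exists_vanish_lt_rank U M (f |: I).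
  have fI : f \notin I by apply/negP => /(subsetP IT); case/setDP: fS => _ /negP.
  by rewrite cardsU1 fI -cI addn2.
have XT : {in f |: T, forall a, X a = Zero}.
  move=> a /setU1P[-> | aT]; first by apply: XI; rewrite setU11.
  by apply: (basis_vanish IT dI cI XL) => // b bI; apply: XI; rewrite setU1r.
have [S0 | [a aS]] := set_0Vmem (S :\ f).
  case/eqP: Xn; apply: (cov_vanish_eq0 fS XL XT) => a.
  by rewrite S0 inE.
by apply/svec_neq0P; exists a; exact: YS.
Qed.

Lemma ground_off_coline : exists f, f \in S.
Proof.
have [I [IT dI cI]] := coline_basis.
have [|X [XL /svec_neq0P[f Xf] XI]] := @exists_vanish_lt_rank U M I.
  by rewrite -cI addn2.
exists f; rewrite inE; apply/andP; split.
  by apply: contraNN Xf => fT; apply/eqP; exact: (basis_vanish IT dI cI XL XI).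
by apply: contraNT Xf => /(cov_out XL)->.
Qed.

(** Some covector that vanishes on [T] and at a single element [e] off [T] is
    positive elsewhere: it is an end of the segment cut out of the supercell by
    the coline. Take one with the most positive entries; if it were negative at
    [a], eliminating [a] against an interior point of the supercell would yield
    one with more. *)
Lemma pencil_first : exists e X, [/\ e \in S, X \in covectors M,
  {in e |: T, forall a, X a = Zero} & {in S :\ e, forall a, X a = Pos}].
Proof.
pose Q := [pred X | (X \in covectors M) && (X != svec0 U) &&
  [forall a in T, X a == Zero] && [exists f in S, X f == Zero]].
have [f fS] := ground_off_coline.
have [Y [YL Y0 _ Yn]] := pencil_generic fS.
have QY : Q Y.
  apply/andP; split; last by apply/exists_inP; exists f; rewrite ?Y0 ?setU11.
  by rewrite YL Yn; apply/forall_inP=> a aT; rewrite Y0 ?setU1r.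
case: (arg_maxnP (fun X : svec U => #|[set a in S | X a == Pos]|) QY).
move=> X /andP[/andP[/andP[XL Xn] /forall_inP XT] /exists_inP[e eS /eqP Xe]] Xmax.
have X0 : {in e |: T, forall a, X a = Zero}.
  by move=> a /setU1P[-> // | /XT/eqP].
have [Z [ZL ZT Zp]] := proper_interior.
exists e, X; split=> // a aSe.
have /setD1P[ae aS] := aSe.
have Xa0 : X a != Zero.
  have [Y' [Y'L Y'0 Y'S Y'n]] := pencil_generic eS.
  have [X00|->|->] := pencil_unique eS Y'L Y'0 Y'n XL X0.
  - by case/eqP: Xn.
  - exact: Y'S.
  by rewrite ffunE sopp_eq0; exact: Y'S.
have [//|Xa] : X a = Pos \/ X a = Neg by case: (X a) Xa0; auto.
have [||W [WL Wa WE]] := @cov_eliminate U M Z X a ZL XL; rewrite ?Zp ?Xa //.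
have Wp b : b \in S -> X b != Neg -> W b = Pos.
  by move=> bS Xb; rewrite WE Zp //; case: (X b) Xb.
have QW : Q W.
  apply/andP; split; last by apply/exists_inP; exists a; rewrite ?Wa.
  rewrite WL; apply/andP; split.
    by apply/svec_neq0P; exists e; rewrite Wp // Xe.
  by apply/forall_inP=> b bT; rewrite WE ZT // X0 // setU1r.
have := Xmax W QW; rewrite /= leqNgt => /negP[]; apply: proper_card.
apply/properP; split.
  by apply/subsetP=> b; rewrite !inE => /andP[bS /eqP Xb]; rewrite bS Wp ?Xb // inE.
exists e; rewrite inE eS; first by rewrite Wp ?Xe.
by rewrite Xe.
Qed.

(** Let [e] be the first element, and let [V f] be the covector of the pencil at
    [f] that is positive off [e] for [f = e] and negative at [e] otherwise. The
    shelling order puts [f] before [g] when [V f] is positive at [g]. *)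
Lemma coline_shelling_exists : exists s, coline_shelling M T s.
Proof.
have [e [X [eS XL X0 XS]]] := pencil_first.
pose C f Y := [/\ Y \in covectors M, {in f |: T, forall a, Y a = Zero},
  {in S :\ f, forall a, Y a != Zero}, Y != svec0 U &
  if f == e then {in S :\ e, forall a, Y a = Pos} else Y e = Neg].
have [V VC] : exists V : U -> svec U, forall f, f \in S -> C f (V f).
  apply: (@fin_all_exists _ (fun=> svec U) (fun f Y => f \in S -> C f Y)) => f.
  have [fS | fS] := boolP (f \in S); last by exists X.
  have [Y [YL Y0 YS Yn]] := pencil_generic fS.
  have [fe | fe] := eqVneq f e.
    exists X => _; rewrite /C fe eqxx; split=> // [a /XS-> //|].
    have /svec_neq0P[a Ya] := Yn; apply/svec_neq0P; exists a.
    rewrite XS //; rewrite !inE; apply/and3P; split.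
    - by apply: contraNN Ya => /eqP->; rewrite -fe Y0 ?setU11.
    - by apply: contraNN Ya => aT; rewrite Y0 ?setU1r.
    by apply: contraNT Ya => /(cov_out YL)->.
  have [Ye | Ye] : Y e = Neg \/ Y e = Pos.
    have: Y e != Zero by apply: YS; rewrite !inE eq_sym fe -in_setD.
    by case: (Y e); auto.
    by exists Y => _; rewrite /C (negPf fe).
  exists (vopp Y) => _; rewrite /C (negPf fe); split.
  - exact: (cov_opp (covectorsP M)).
  - by move=> a /Y0 Ya; rewrite ffunE Ya.
  - by move=> a /YS Ya; rewrite ffunE sopp_eq0.
  - by apply/svec_neq0P; exists e; rewrite ffunE Ye.
  by rewrite ffunE Ye.
have Vuniq f W : f \in S -> W \in covectors M ->
    {in f |: T, forall a, W a = Zero} -> [\/ W = svec0 U, W = V f | W = vopp (V f)].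
  move=> fS; have [VL V0 _ Vn _] := VC f fS; exact: pencil_unique.
have Vne f g : f \in S -> g \in S -> g != f -> V f g != Zero.
  move=> fS gS gf; have [_ _ VS _ _] := VC f fS; apply: VS.
  by rewrite !inE gf -in_setD.
have Ve g : g \in S -> g != e -> V e g = Pos.
  move=> gS ge; have [_ _ _ _] := VC e eS; rewrite eqxx; apply.
  by rewrite !inE ge -in_setD.
have Vneg f : f \in S -> f != e -> V f e = Neg.
  by move=> fS fe; have [_ _ _ _] := VC f fS; rewrite (negPf fe).
have V0 f : f \in S -> V f f = Zero.
  by move=> fS; have [_ V0 _ _ _] := VC f fS; rewrite V0 ?setU11.
have VT f a : f \in S -> a \in T -> V f a = Zero.
  by move=> fS aT; have [_ {}V0 _ _ _] := VC f fS; rewrite V0 ?setU1r.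
have VL f : f \in S -> V f \in covectors M by case/VC.
(* eliminating e from V f and - V g gives a covector of the pencil at e, which
   has constant sign off e *)
have Vcmp f g : f \in S -> g \in S -> f != e -> g != e -> exists W,
    [\/ W = svec0 U, W = V e | W = vopp (V e)] /\
    forall a, ~~ ((V f a != Zero) && (V f a == V g a)) ->
      W a = if V f a == Zero then sopp (V g a) else V f a.
  move=> fS gS fe ge.
  have [|||W [WL We WE]] := @cov_eliminate U M (V f) (vopp (V g)) e (VL f fS).
  - exact/(cov_opp (covectorsP M))/VL.
  - by rewrite Vneg.
  - by rewrite ffunE !Vneg.
  exists W; split; first apply: Vuniq => //.
    move=> a /setU1P[-> // | aT]; rewrite WE ffunE !VT //.
  by move=> a Va; rewrite WE ffunE ?soppK.
have Vanti f g : f \in S -> g \in S -> f != g -> V g f = sopp (V f g).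
  move=> fS gS fg; have gf : g != f by rewrite eq_sym.
  have [fe | fe] := eqVneq f e; first by rewrite fe Ve ?Vneg // -fe.
  have [ge | ge] := eqVneq g e; first by rewrite ge Ve ?Vneg // -fe.
  have [W [Wc WE]] := Vcmp f g fS gS fe ge.
  have := WE f; rewrite V0 // eqxx /= => /(_ isT).
  have := WE g; rewrite (V0 g) // andbC.
  have := Vne f g fS gS gf; have := Vne g f gS fS fg.
  case: Wc => ->; rewrite ?ffunE ?Ve //;
  by case: (V f g) (V g f) => [] [] //= _ _ /(_ isT).
pose le f g := (f == g) || (V f g == Pos).
have le_tr : {in S & &, transitive le}.
  move=> g f h gS fS hS; rewrite /le.
  have [-> // | fg /=] := eqVneq f g; have [-> -> | gh /=] := eqVneq g h.
    by rewrite orbT.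
  move=> /eqP Vfg /eqP Vgh; have [// | fh /=] := eqVneq f h.
  have [fe | fe] := eqVneq f e; first by rewrite fe Ve // -fe eq_sym.
  have [ge | ge] := eqVneq g e; first by move: Vfg; rewrite ge Vneg.
  have [W [Wc WE]] := Vcmp f g fS gS fe ge.
  have := WE f; rewrite V0 // eqxx /= => /(_ isT).
  rewrite (Vanti f g) // Vfg /=.
  have := WE h; rewrite Vgh; have := Vne f h fS hS; rewrite eq_sym => /(_ fh).
  have [he | he] := eqVneq h e; first by move: Vgh; rewrite he Vneg.
  case: Wc => ->; rewrite ?ffunE ?Ve //;
  by case: (V f h) => //= _ /(_ isT).
have le_tot : {in S &, total le}.
  move=> f g fS gS; rewrite /le eq_sym.
  have [// | gf /=] := eqVneq g f; rewrite (Vanti g f) //.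
  by have := Vne g f gS fS; rewrite eq_sym gf => /(_ isT); case: (V g f).
pose s := sort le (enum S).
have sS a : (a \in s) = (a \in S) by rewrite mem_sort mem_enum.
have s_sorted : sorted le s.
  by apply: (sort_sorted_in le_tot); apply/allP=> a; rewrite mem_enum.
have s_uniq : uniq s by rewrite sort_uniq enum_uniq.
have s_le a b : a \in S -> b \in S -> index a s < index b s -> V a b = Pos.
  move=> aS bS ab; have: le a b.
    apply: (sorted_ltn_index_in _ s_sorted) => //; rewrite ?sS //.
    by move=> y x z; rewrite !sS; exact: le_tr.
  by rewrite /le => /orP[/eqP ab'|/eqP//]; move: ab; rewrite ab' ltnn.
have sV f : f \in S -> shelling_vector s f = V f.
  move=> fS; apply/ffunP=> a; rewrite ffunE sS.
  have [aS | aS] /= := boolP (a \in S); last first.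
    have [aT | aT] := boolP (a \in T); first by rewrite VT.
    have aE : a \notin E by move: aS; rewrite !inE aT.
    by rewrite (cov_out (VL f fS) aE).
  have [-> | af] := eqVneq a f; first by rewrite V0.
  case: ltngtP => [afi | fai | eq_i].
  - by rewrite (Vanti a f) // s_le.
  - by rewrite s_le.
  by case/eqP: af; rewrite -(nth_index f (_ : a \in s)) ?sS // eq_i nth_index ?sS.
exists s; split; first by rewrite perm_sort.
move=> f; rewrite sS => fS; rewrite sV //.
have [VfL Vf0 VfS Vfn _] := VC f fS; rewrite /cocircuit VfL Vfn /=.
apply/forall_inP=> Y /andP[YL Yn]; apply/implyP=> /subsetP sY.
have /(Vuniq f Y fS YL)[Y0|->|->] : {in f |: T, forall a, Y a = Zero}.
- move=> a aT; apply/eqP; apply: contraT => Ya.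
  by have := sY a; rewrite !inE Ya Vf0 // => /(_ isT).
- by case/eqP: Yn.
- by [].
by apply/eqP/setP=> a; rewrite !inE ffunE sopp_eq0.
Qed.

End Fixation.

(** * The supercell along a coline shelling *)

Section Shelling.
Variables (U : finType) (M : oriented_matroid U) (T : {set U}) (s : seq U).
Hypotheses (colineT : coline M T) (properT : proper M T).
Hypothesis shelling_s : coline_shelling M T s.
Implicit Types (I : {set U}) (X Y W : svec U) (e f g i j : U).
Local Notation E := (ground M).
Local Notation S := (ground M :\: T).
Local Notation V := (shelling_vector s).
Local Notation P := (supercell M T).

Lemma voppE X e : vopp X e = sopp (X e). Proof. by rewrite ffunE. Qed.

Lemma supercellP X :
  reflect (X \in covectors M /\ {in S, forall g, X g != Neg}) (X \in P).
Proof.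
rewrite inE; apply: (iffP andP) => [[XL /forall_inP XP] | [XL XP]]; split=> //.
  by move=> g /XP; case: (X g).
by apply/forall_inP=> g /XP; case: (X g).
Qed.

Lemma mem_shelling f : (f \in s) = (f \in S).
Proof. by have [/perm_mem-> _] := shelling_s; rewrite mem_enum. Qed.

Lemma shelling_cov f : f \in S -> V f \in covectors M.
Proof.
by have [_ cV] := shelling_s; rewrite -mem_shelling => /cV/and3P[].
Qed.

Lemma shelling_neq0 f : f \in S -> V f != svec0 U.
Proof.
by have [_ cV] := shelling_s; rewrite -mem_shelling => /cV/and3P[].
Qed.

Lemma shelling_zero f : {in f |: T, forall a, V f a = Zero}.
Proof.
move=> a /setU1P[-> | aT]; first by rewrite ffunE eqxx orbT.
by rewrite ffunE mem_shelling !inE aT.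
Qed.

Lemma shelling_self f : V f f = Zero.
Proof. by rewrite shelling_zero ?setU11. Qed.

Lemma shelling_neg f g : g \in S -> index g s < index f s -> V f g = Neg.
Proof.
move=> gS gf; rewrite ffunE mem_shelling gS gf /=.
by case: eqP gf => // ->; rewrite ltnn.
Qed.

Lemma shelling_pos f g : g \in S -> index f s < index g s -> V f g = Pos.
Proof.
move=> gS fg; rewrite ffunE mem_shelling gS /= ltnNge ltnW //=.
by case: eqP fg => // ->; rewrite ltnn.
Qed.

Lemma index_shelling_inj f g : f \in S -> index f s = index g s -> f = g.
Proof.
rewrite -mem_shelling => fs fg; rewrite -(nth_index f fs) fg nth_index //.
by rewrite -index_mem -fg index_mem.
Qed.

Lemma shelling_posE f g : g \in S -> f \in S -> (V f g == Pos) = (index f s < index g s).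
Proof.
move=> gS fS; case: ltngtP => [fg | gf | /(index_shelling_inj fS)<-].
- by rewrite shelling_pos.
- by rewrite shelling_neg.
by rewrite shelling_self.
Qed.

Lemma shelling_negE f g : g \in S -> f \in S -> (V f g == Neg) = (index g s < index f s).
Proof.
move=> gS fS; case: ltngtP => [fg | gf | /(index_shelling_inj gS)->].
- by rewrite shelling_neg.
- by rewrite shelling_pos.
by rewrite shelling_self.
Qed.

Lemma shelling_nz f g : f \in S -> g \in S -> g != f -> V f g != Zero.
Proof.
move=> fS gS; case: (ltngtP (index f s) (index g s)) => [fg | gf | fg].
- by rewrite shelling_pos.
- by rewrite shelling_neg.
by rewrite (index_shelling_inj fS fg) eqxx.
Qed.

Lemma shelling_unique f W : f \in S -> W \in covectors M ->
  {in f |: T, forall a, W a = Zero} -> [\/ W = svec0 U, W = V f | W = vopp (V f)].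
Proof.
move=> fS; apply: (pencil_unique colineT properT fS).
- exact: shelling_cov.
- exact: shelling_zero.
exact: shelling_neq0.
Qed.

Lemma shelling_first : exists e, [/\ e \in S, V e \in P &
  {in S, forall g, g != e -> index e s < index g s}].
Proof.
have [f fS] := ground_off_coline colineT.
case Ds: s (mem_shelling f) => [|e s']; first by rewrite fS.
have eS : e \in S by rewrite -mem_shelling Ds mem_head.
have lt0 g : g != e -> 0 < index g (e :: s') by move=> ge /=; rewrite eq_sym (negPf ge).
have ie : index e (e :: s') = 0 by rewrite /= eqxx.
move=> _; exists e; split=> // [|g _ /lt0]; last by rewrite ie.
rewrite -Ds; apply/supercellP; split=> [|g gS]; first exact: shelling_cov.
have [-> | /lt0 ge] := eqVneq g e; first by rewrite shelling_self.
by rewrite shelling_pos // Ds ie.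
Qed.

Lemma shelling_last : exists e, [/\ e \in S &
  {in S, forall g, g != e -> index g s < index e s}].
Proof.
have [f fS] := ground_off_coline colineT.
case: (@arg_maxnP _ f (fun g => g \in S) (fun g => index g s) fS) => e eS emax.
exists e; split=> // g gS ge.
rewrite ltn_neqAle (emax g gS : index g s <= _) andbT.
by apply: contraNneq ge => /(index_shelling_inj gS)->.
Qed.

Lemma face_facet f : f \in S -> face M T f \in facets M T.
Proof. by have /and3P[_ _ /forall_inP] := properT; apply. Qed.

Lemma face_maximal e f : e \in S -> f \in S ->
  face M T e \subset face M T f -> face M T f = face M T e.
Proof.
move=> /face_facet; rewrite inE => /maxsetP[_ max] fS; apply: max.
by apply/imsetP; exists f.
Qed.

Lemma face_neq_first e f : f \in S -> V e \in P -> f != e -> face M T f != face M T e.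
Proof.
move=> fS VeP fe; apply: contraNneq (fe) => Ef.
have VeL : V e \in face M T f by rewrite Ef inE VeP shelling_self eqxx.
move: VeL; rewrite inE => /andP[_]; rewrite ffunE mem_shelling fS (negPf fe) /=.
by case: ifP.
Qed.

(** A face reduced to the origin would lie strictly inside the face of the first
    element. *)
Lemma face_nontrivial f : f \in S -> exists X, [/\ X \in P, X f = Zero & X != svec0 U].
Proof.
move=> fS; have [e [eS VeP _]] := shelling_first.
have [fe | fe] := eqVneq f e.
  by exists (V e); rewrite fe shelling_self shelling_neq0.
have [|nX] := boolP [exists X in face M T f, X != svec0 U].
  by case/exists_inP=> X; rewrite inE => /andP[XP /eqP Xf] Xn; exists X.
case/eqP: (face_neq_first fS VeP fe); apply/esym/face_maximal => //.
apply/subsetP=> X Xf; have [-> | Xn] := eqVneq X (svec0 U).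
  rewrite inE ffunE eqxx andbT; apply/supercellP; split; first exact: cov_zero (covectorsP M).
  by move=> g _; rewrite ffunE.
by case/exists_inP: nX; exists X.
Qed.

(** * Rank two *)

Section RankTwo.
Hypothesis rank2 : rank M = 2.

(** In rank two every element is an end of the shelling. *)
Lemma rank2_shelling f : f \in S -> V f \in P \/ vopp (V f) \in P.
Proof.
move=> fS; have [X [XP Xf Xn]] := face_nontrivial fS; have [XL _] := supercellP _ XP.
have [I [IT dI cI]] := coline_basis colineT.
have I0 : I = set0 by apply/eqP; rewrite -cards_eq0 -(eqn_add2r 2) cI rank2.
have XT := basis_vanish colineT IT dI cI XL.
have [||<-|<-] := @shelling_unique f X fS XL; [|by move=> X0; case/eqP: Xn|by left|by right].
by move=> a /setU1P[-> // |]; apply: XT; rewrite I0 => b; rewrite inE.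
Qed.

(** Hence there are only two elements, and the shelling digraph is an edge. *)
Lemma rank2_holt_klee : holt_klee S (shelling_edge M T s) 1.
Proof.
have inS a : a \in s -> a \in S by rewrite mem_shelling.
have us : uniq s by have [/perm_uniq-> _] := shelling_s; rewrite enum_uniq.
have [a [b [Ds ab]]] : exists a b, s = [:: a; b] /\ a != b.
  case Ds: s us => [|a [|b [|c s']]] us.
  - have [f fS] := ground_off_coline colineT.
    by have := mem_shelling f; rewrite Ds fS.
  - have aS : a \in S by rewrite -mem_shelling Ds mem_head.
    case/eqP: (shelling_neq0 aS); apply: (cov_vanish_eq0 aS).
    + exact: shelling_cov.
    + exact: shelling_zero.
    + by move=> g /setD1P[ga]; rewrite -mem_shelling Ds inE (negPf ga).
  - by exists a, b; split=> //; move: us; rewrite /= inE andbT.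
  have bS : b \in S by rewrite -mem_shelling Ds !inE eqxx orbT.
  have aS : a \in S by rewrite -mem_shelling Ds mem_head.
  have cS : c \in S by rewrite -mem_shelling Ds !inE eqxx !orbT.
  move: us => /= /and3P[]; rewrite !inE !negb_or => /and3P[ab ac _] /andP[bc _] _.
  have Vba : V b a = Neg.
    by apply: shelling_neg; rewrite // Ds /= eqxx (negPf ab).
  have Vbc : V b c = Pos.
    by apply: shelling_pos; rewrite // Ds /= eqxx (negPf ab) (negPf ac) (negPf bc).
  have [/supercellP[_ /(_ a aS)] | /supercellP[_ /(_ c cS)]] := rank2_shelling bS.
    by rewrite Vba.
  by rewrite ffunE Vbc.
have Sab z : (z \in S) = (z == a) || (z == b) by rewrite -mem_shelling Ds !inE.
have aS : a \in S by rewrite Sab eqxx.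
have bS : b \in S by rewrite Sab eqxx orbT.
have ia : index a s = 0 by rewrite Ds /= eqxx.
have ib : index b s = 1 by rewrite Ds /= eqxx (negPf ab).
have VaP : V a \in P.
  apply/supercellP; split=> [|g]; first exact: shelling_cov.
  rewrite Sab => /orP[] /eqP->; first by rewrite shelling_self.
  by rewrite shelling_pos // ia ib.
have ba : b != a by rewrite eq_sym.
have nab := face_neq_first bS VaP ba.
have facetsP F : F \in facets M T -> F = face M T a \/ F = face M T b.
  rewrite inE => /maxsetp/imsetP[f].
  by rewrite Sab => /orP[] /eqP-> ->; auto.
have adj : adjacent M T a b.
  apply/maxsetP; split.
    apply/imset2P; exists (face M T a) (face M T b); rewrite ?face_facet //.
    by rewrite inE face_facet //= eq_sym.
  move=> B /imset2P[F G FF]; rewrite inE => /andP[GF FG] -> _.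
  case: (facetsP F FF) (facetsP G GF) FG => -> [] ->; rewrite ?eqxx // setIC //.
have edgeE x y : shelling_edge M T s x y = (x == a) && (y == b).
  rewrite /shelling_edge !mem_shelling !Sab.
  apply/and4P/andP => [[/orP[]/eqP-> /orP[]/eqP->] | [/eqP-> /eqP->]];
    rewrite ?ia ?ib ?eqxx ?orbT ?adj //.
exists a, b; split.
- move=> z; rewrite /is_source Sab; have [-> | za] /= := eqVneq z a.
    by apply/forall_inP=> y _; rewrite edgeE (negPf ab) andbF.
  apply/negP=> /andP[/eqP-> /forall_inP/(_ a aS)].
  by rewrite edgeE !eqxx.
- move=> z; rewrite /is_sink Sab; have [-> | zb] /= := eqVneq z b.
    by rewrite orbT; apply/forall_inP=> y _; rewrite edgeE (negPf ba).
  rewrite orbF; apply/negP=> /andP[/eqP-> /forall_inP/(_ b bS)].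
  by rewrite edgeE !eqxx.
exists (fun=> [:: b]); split=> [i | i j]; last by rewrite !ord1 eqxx.
by rewrite /dipath /= edgeE !eqxx inE ab.
Qed.

End RankTwo.


(** * Rank three: pseudolines and their crossings *)

Section RankThree.
Hypothesis rank3 : rank M = 3.
(* a nonloop of the rank-one flat T; its sign separates the two sides of T *)
Variable t : U.
Hypotheses (tT : t \in T)
  (t_basis : forall W, W \in covectors M -> W t = Zero -> {in T, forall a, W a = Zero}).

Lemma line_at_t i W : i \in S -> W \in covectors M -> W i = Zero -> W t = Zero ->
  [\/ W = svec0 U, W = V i | W = vopp (V i)].
Proof.
move=> iS WL Wi Wt; apply: shelling_unique => // a /setU1P[-> // |].
exact: t_basis.
Qed.

Lemma pair_independent e f : e \in S -> f \in S -> e != f -> independent M [set e; f].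
Proof.
move=> eS fS ef; have [Z [ZL ZT Zp]] := proper_interior properT.
have d0 : independent M set0.
  by apply/independentP; split=> [|a]; rewrite ?sub0set ?inE.
have de : independent M [set e].
  rewrite -(setU0 [set e]); apply: (independentU1 d0 ZL) => [a|].
    by rewrite inE.
  by rewrite Zp.
rewrite setUC; apply: (independentU1 de (shelling_cov eS)).
  by move=> a /set1P->; exact: shelling_self.
by apply: shelling_nz => //; rewrite eq_sym.
Qed.

Lemma crossing_exists e f : exists X, [/\ X \in covectors M, X != svec0 U,
  X e = Zero & X f = Zero].
Proof.
have [|X [XL Xn X0]] := @exists_vanish_lt_rank U M [set e; f].
  by rewrite rank3 cards2; case: (_ != _).
by exists X; split=> //; apply: X0; rewrite !inE eqxx ?orbT.
Qed.

Lemma crossing_unique e f X Y : e \in S -> f \in S -> e != f ->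
  X \in covectors M -> X e = Zero -> X f = Zero -> X != svec0 U ->
  Y \in covectors M -> Y e = Zero -> Y f = Zero ->
  [\/ Y = svec0 U, Y = X | Y = vopp X].
Proof.
move=> eS fS ef XL Xe Xf Xn YL Ye Yf.
apply: (corank1_unique (pair_independent eS fS ef)) => //.
- by rewrite rank3 cards2 ef.
- by move=> a /set2P[] ->.
by move=> a /set2P[] ->.
Qed.

Lemma crossing_t e f X : e \in S -> f \in S -> e != f ->
  X \in covectors M -> X e = Zero -> X f = Zero -> X != svec0 U -> X t != Zero.
Proof.
move=> eS fS ef XL Xe Xf Xn; apply/eqP => Xt.
have fe : f != e by rewrite eq_sym.
have Vef := shelling_nz eS fS fe.
case: (line_at_t eS XL Xe Xt) => XE; first by case/eqP: Xn.
  by rewrite -XE Xf in Vef.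
by have := congr1 (fun W : svec U => W f) XE; rewrite ffunE Xf; case: (V e f) Vef.
Qed.

Lemma crossing_side sg e f : sg != Zero -> e \in S -> f \in S -> e != f ->
  exists X, [/\ X \in covectors M, X e = Zero, X f = Zero & X t = sg].
Proof.
move=> sg0 eS fS ef; have [X [XL Xn Xe Xf]] := crossing_exists e f.
have Xt := crossing_t eS fS ef XL Xe Xf Xn.
have [<- | Xs] := eqVneq (X t) sg; first by exists X.
exists (vopp X); split; rewrite ?ffunE ?Xe ?Xf //.
  exact: cov_opp (covectorsP M) _ XL.
by case: (X t) sg Xt Xs sg0 => [] [].
Qed.

(** Two points of the pseudoline [i] on the same side of the coline differ by a
    multiple of the point [V i] of the coline. *)
Lemma line_difference i X Y : i \in S ->
  X \in covectors M -> X i = Zero -> X t != Zero ->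
  Y \in covectors M -> Y i = Zero -> Y t = X t ->
  exists W, [\/ W = svec0 U, W = V i | W = vopp (V i)] /\
    forall g, ~~ ((X g != Zero) && (X g == Y g)) ->
      W g = if X g == Zero then sopp (Y g) else X g.
Proof.
move=> iS XL Xi Xt YL Yi Yt.
have [|||W [WL Wt WE]] := @cov_eliminate U M X (vopp Y) t XL => //.
- exact: cov_opp (covectorsP M) _ YL.
- by rewrite ffunE Yt.
exists W; split.
  by apply: line_at_t => //; rewrite WE ffunE Xi // Yi.
by move=> g Xg; rewrite WE ffunE // soppK.
Qed.

(** The pseudoline [i] meets the supercell on the side [sg] of the coline. With
    the coline at infinity, the part of the supercell on that side is bounded by
    an envelope of the arrangement, and [i] touches it. *)
Definition on_envelope sg i := exists X, [/\ X \in P, X i = Zero & X t = sg].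

(** Let [D] be one of the two points of the coline on the pseudoline [i]. If [i]
    meets the supercell on the side [sg], then among its crossings on that side
    with the pseudolines [j] such that [D j] is positive, the nearest to [D]
    belongs to the supercell. It is found as the crossing that is nonnegative at
    the most elements of that kind. *)
Lemma next_crossing sg i j0 D : sg != Zero -> i \in S -> on_envelope sg i ->
  D = V i \/ D = vopp (V i) -> j0 \in S -> D j0 = Pos ->
  exists j X, [/\ j \in S, D j = Pos, X \in P, X t = sg & X i = Zero /\ X j = Zero].
Proof.
move=> sg0 iS [A [AP Ai At]] Di j0S Dj0.
have [AL Ap] := supercellP _ AP.
have Dcmp X Y : X \in covectors M -> X i = Zero -> X t = sg ->
    Y \in covectors M -> Y i = Zero -> Y t = sg ->
    exists W, [\/ W = svec0 U, W = D | W = vopp D] /\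
    forall g, ~~ ((X g != Zero) && (X g == Y g)) ->
      W g = if X g == Zero then sopp (Y g) else X g.
  move=> XL Xi Xt YL Yi Yt; have Yt' : Y t = X t by rewrite Yt.
  have Xt0 : X t != Zero by rewrite Xt.
  have [W [Wc WE]] := line_difference iS XL Xi Xt0 YL Yi Yt'.
  exists W; split=> //; case: Di => ->; first by [].
  have VK : vopp (vopp (V i)) = V i by apply/ffunP=> a; rewrite !ffunE soppK.
  by rewrite VK; case: Wc; [constructor 1 | constructor 3 | constructor 2].
have iD g : D g != Zero -> i != g.
  by apply: contraNneq => <-; case: Di => ->; rewrite ?voppE shelling_self.
pose Q := [pred X : svec U | [&& X \in covectors M, X i == Zero, X t == sg &
  [exists j in S, (D j == Pos) && (X j == Zero)]]].
have Qex j : j \in S -> D j = Pos -> exists2 X, Q X & X j = Zero.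
  move=> jS Dj; have ij : i != j by apply: iD; rewrite Dj.
  have [X [XL Xi Xj Xt]] := crossing_side sg0 iS jS ij.
  exists X => //; rewrite /Q /= XL Xi Xt !eqxx; apply/exists_inP; exists j => //.
  by rewrite Dj Xj.
have [X0 QX0 _] := Qex j0 j0S Dj0.
case: (arg_maxnP (fun X : svec U =>
  #|[set g in S | (D g == Pos) && (X g != Neg)]|) QX0) => X.
move=> /and4P[XL /eqP Xi /eqP Xt /exists_inP[j jS /andP[/eqP Dj /eqP Xj]]] Xmax.
exists j, X; split=> //; apply/supercellP; split=> // g gS.
apply/negP=> /eqP Xg.
have [gi | gi] := eqVneq i g; first by rewrite -gi Xi in Xg.
have Dg0 : D g != Zero.
  have gi' : g != i by rewrite eq_sym.
  have := shelling_nz iS gS gi'.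
  by case: Di => -> //; rewrite voppE sopp_eq0.
have [Dg | Dg] : D g = Pos \/ D g = Neg by case: (D g) Dg0; auto.
  have [Y QY Yg] := Qex g gS Dg; have := Xmax Y QY.
  have /and4P[YL /eqP Yi /eqP Yt _] := QY.
  have [W [Wc WE]] := Dcmp X Y XL Xi Xt YL Yi Yt.
  have Wg : W g = Neg by rewrite WE Xg ?Yg.
  (* so the difference of X and Y is negative wherever D is positive *)
  have Wneg l : D l = Pos -> W l = Neg.
    move=> Dl; case: Wc Wg => ->; rewrite ?voppE ?Dg ?Dl //.
    by rewrite ffunE.
  have XY l : D l = Pos -> X l != Neg -> Y l != Neg.
    move=> /Wneg Wl Xl; apply/negP=> /eqP Yl.
    by move: Wl; rewrite WE Yl; case: (X l) Xl.
  rewrite /= leqNgt => /negP[]; apply: proper_card; apply/properP; split.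
    apply/subsetP=> l; rewrite !inE => /and3P[-> /eqP Dl Xl] /=.
    by rewrite Dl XY.
  by exists g; rewrite !inE -in_setD gS Dg ?Yg // Xg.
(* D is negative at g: compare X with the given point A of the supercell *)
have [W [Wc WE]] := Dcmp A X AL Ai At XL Xi Xt.
have Wg : W g = Pos.
  by rewrite WE Xg; have := Ap g gS; case: (A g).
have := WE j; rewrite Xj; have := Ap j jS.
case: Wc Wg => ->; rewrite ?ffunE ?Dg // => _.
by rewrite Dj; case: (A j) => //= _ /(_ isT).
Qed.

Lemma shelling_other i : i \in S -> exists2 f, f \in S & i != f.
Proof.
move=> iS; have /svec_neq0P[f Vf] := shelling_neq0 iS.
exists f; last by apply: contraNneq Vf => <-; rewrite shelling_self.
rewrite inE; apply/andP; split.
  by apply: contraNN Vf => fT; rewrite shelling_zero ?setU1r.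
by apply: contraNT Vf => /(cov_out (shelling_cov iS))->.
Qed.

(** An end of the trace of the coline in the supercell can be moved off the
    coline, to either side, within its pseudoline and the supercell. *)
Lemma on_envelope_end sg i D : sg != Zero -> i \in S ->
  D = V i \/ D = vopp (V i) -> D \in P -> on_envelope sg i.
Proof.
move=> sg0 iS Di DP; have [f fS i_f] := shelling_other iS.
have [X [XL Xi _ Xt]] := crossing_side sg0 iS fS i_f.
have [DL Dp] := supercellP _ DP.
have D0 a : a \in i |: T -> D a = Zero.
  by move=> aT; case: Di => ->; rewrite ?voppE shelling_zero.
exists (vcomp D X); split.
- apply/supercellP; split=> [|g gS]; first exact: (cov_comp (covectorsP M)).
  rewrite ffunE; have := Dp g gS; have [Dg _ | //] := eqVneq (D g) Zero.
  have [<- | gi] := eqVneq i g; first by rewrite Xi.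
  have gi' : g != i by rewrite eq_sym.
  by have := shelling_nz iS gS gi'; case: Di Dg => -> Dg;
    move: Dg; rewrite ?voppE; case: (V i g).
- by rewrite ffunE D0 ?setU11.
by rewrite ffunE D0 ?setU1r.
Qed.

Lemma on_envelope_exists i : i \in S -> exists2 sg, sg != Zero & on_envelope sg i.
Proof.
move=> iS; have [X [XP Xi Xn]] := face_nontrivial iS.
have [XL _] := supercellP _ XP.
have [Xt | Xt] := eqVneq (X t) Zero; last by exists (X t) => //; exists X.
exists Pos => //; apply: (on_envelope_end _ iS _ XP) => //.
by case: (line_at_t iS XL Xi Xt); [move=> X0; case/eqP: Xn | left | right].
Qed.

(* an element that is neither the first nor the last of the shelling *)
Section Inner.
Variable i : U.
Hypotheses (iS : i \in S) (ViP : V i \notin P) (ViN : vopp (V i) \notin P).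

(** Eliminating [t] from two points of the pseudoline [i] in the supercell, on
    opposite sides of the coline, gives a point of the coline in the supercell.
    For an inner [i] it can only be the origin. *)
Lemma inner_opposite_vanish X Y : X \in P -> X i = Zero -> X t != Zero ->
  Y \in P -> Y i = Zero -> Y t = sopp (X t) -> {in S, forall g, Y g = Zero}.
Proof.
move=> XP Xi Xt YP Yi Yt; have [XL Xp] := supercellP _ XP.
have [YL Yp] := supercellP _ YP.
have [||W [WL Wt WE]] := @cov_eliminate U M Y X t YL XL.
- by rewrite Yt sopp_eq0.
- by rewrite Yt soppK.
have WEg g : g \in S -> W g = if Y g == Zero then X g else Y g.
  by move=> gS; apply: WE; have := Xp g gS; have := Yp g gS; case: (X g) (Y g) => [] [].
have WP : W \in P.
  apply/supercellP; split=> // g gS; rewrite WEg //.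
  by case: ifP => _; [exact: Xp | exact: Yp].
have Wi : W i = Zero by rewrite WEg // Xi Yi.
case: (line_at_t iS WL Wi Wt) => W0; last 2 first.
- by case/negP: ViP; rewrite -W0.
- by case/negP: ViN; rewrite -W0.
move=> g gS; have := WEg g gS; rewrite W0 ffunE.
by case: (Y g).
Qed.

(** Otherwise every covector in the face of [i] would vanish off [T], so that face
    would be contained in the face of the first element. *)
Lemma inner_envelope_disjoint : on_envelope Pos i -> on_envelope Neg i -> False.
Proof.
move=> [X [XP Xi Xt]] [Y [YP Yi Yt]].
have [e [eS VeP _]] := shelling_first.
have ie : i != e by apply: contraNneq ViP => ->.
case/eqP: (face_neq_first iS VeP ie); apply/esym/face_maximal => //.
apply/subsetP=> W; rewrite !inE -/(supercell M T) => /andP[WP /eqP Wi].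
have {}WP : W \in P by rewrite inE.
have [WL _] := supercellP _ WP.
move: (WP); rewrite inE => -> /=; apply/eqP.
case Wt: (W t).
- by apply: (@inner_opposite_vanish X W) => //; rewrite ?Xt ?Wt.
- case: (line_at_t iS WL Wi Wt) => W0; first by rewrite W0 ffunE.
    by case/negP: ViP; rewrite -W0.
  by case/negP: ViN; rewrite -W0.
by apply: (@inner_opposite_vanish Y W) => //; rewrite ?Yt ?Wt.
Qed.

End Inner.

(** If distinct elements had the same face, the first one [h] in the shelling among
    those with that face would, by [next_crossing], have its face contained in
    that of an earlier element. *)
Lemma face_inj e f : e \in S -> f \in S -> e != f -> face M T e != face M T f.
Proof.
move=> eS fS ef; apply/eqP=> Eef.
pose C := [pred g | (g \in S) && (face M T g == face M T e)].
have Ce : C e by rewrite /C /= eS eqxx.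
case: (arg_minnP (fun g => index g s) Ce) => h /andP[hS /eqP Eh] hmin.
have [h' [h'S h'h Eh']] : exists h', [/\ h' \in S, h' != h & face M T h' = face M T h].
  have [eh | eh] := eqVneq e h; last by exists e; rewrite Eh.
  by exists f; rewrite Eh -Eef -eh eq_sym.
have [e1 [e1S Ve1P e1min]] := shelling_first.
have [he1 | he1] := eqVneq h e1.
  by subst h; case/eqP: (face_neq_first h'S Ve1P h'h).
have [sg sg0 up] := on_envelope_exists hS.
have De1 : vopp (V h) e1 = Pos by rewrite voppE shelling_neg // e1min.
have [j [X [jS Dj XP Xt [Xh Xj]]]] := next_crossing sg0 hS up (or_intror erefl) e1S De1.
have [XL _] := supercellP _ XP.
have Xn : X != svec0 U by apply/svec_neq0P; exists t; rewrite Xt.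
have in_face Y : Y \in face M T h -> [/\ Y \in covectors M, Y h = Zero & Y h' = Zero].
  move=> Yh; have := Yh; rewrite -{1}Eh' !inE => /andP[/andP[YL _] /eqP Yh'].
  by move: Yh; rewrite !inE => /andP[_ /eqP].
have [_ _ Xh'] : [/\ X \in covectors M, X h = Zero & X h' = Zero].
  by apply: in_face; rewrite inE XP Xh.
have Ej : face M T j = face M T h.
  apply: face_maximal => //; apply/subsetP=> Y Yh.
  have [YL Yh0 Yh'] := in_face Y Yh.
  move: Yh; rewrite [_ \in face _ _ h]inE [_ \in face _ _ j]inE => /andP[-> _] /=.
  have hh' : h != h' by rewrite eq_sym.
  case: (crossing_unique hS h'S hh' XL Xh Xh' Xn YL Yh0 Yh') => ->.
  - by rewrite ffunE.
  - by rewrite Xj.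
  by rewrite voppE Xj.
have : index h s <= index j s by apply: (hmin j); rewrite inE jS Ej Eh eqxx.
rewrite leqNgt -shelling_negE //; move: Dj; rewrite voppE.
by case: (V h j).
Qed.

(** Two facets with a common vertex are adjacent: an intersection of two facets
    consists of the points of the supercell among the origin, a crossing and its
    opposite, so it is determined by any nonzero point. *)
Lemma crossing_adjacent e f X : e \in S -> f \in S -> e != f ->
  X \in P -> X e = Zero -> X f = Zero -> X != svec0 U -> adjacent M T e f.
Proof.
move=> eS fS ef XP Xe Xf Xn; have [XL _] := supercellP _ XP.
apply/maxsetP; split.
  apply/imset2P; exists (face M T e) (face M T f); rewrite ?face_facet //.
  by rewrite inE face_facet // face_inj.
move=> B /imset2P[F G]; rewrite !inE.
move=> /maxsetp/imsetP[a aS ->] /andP[/maxsetp/imsetP[b bS ->] Eab] -> sub.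
have ab : a != b by apply: contraNneq Eab => ->.
have XB : X \in face M T a :&: face M T b.
  by apply: (subsetP sub); rewrite inE [_ \in face _ _ e]inE [_ \in face _ _ f]inE XP Xe Xf.
have [Xa Xb] : X a = Zero /\ X b = Zero.
  move: XB; rewrite inE [_ \in face _ _ a]inE [_ \in face _ _ b]inE.
  by move=> /andP[/andP[_ /eqP ->] /andP[_ /eqP ->]].
apply/eqP; rewrite eqEsubset sub andbT; apply/subsetP=> Y.
rewrite !in_setI ![_ \in face _ _ _]in_set.
move=> /andP[/andP[YP /eqP Ya] /andP[_ /eqP Yb]]; rewrite YP /=.
have [YL _] := supercellP _ YP.
case: (crossing_unique aS bS ab XL Xa Xb Xn YL Ya Yb) => ->.
- by rewrite !ffunE.
- by rewrite Xe Xf.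
by rewrite !voppE Xe Xf.
Qed.

(** * The two directed paths *)

Local Notation edge := (shelling_edge M T s).

Lemma envelope_next sg i j0 : sg != Zero -> i \in S -> on_envelope sg i -> j0 \in S ->
  index i s < index j0 s -> exists j, [/\ j \in S, edge i j & on_envelope sg j].
Proof.
move=> sg0 iS up j0S ij0; have Vj0 := shelling_pos j0S ij0.
have [j [X [jS Vj XP Xt [Xi Xj]]]] := next_crossing sg0 iS up (or_introl erefl) j0S Vj0.
exists j; split=> //; last by exists X.
have ij : index i s < index j s by rewrite -shelling_posE // Vj.
rewrite /shelling_edge !mem_shelling iS jS ij; apply: (@crossing_adjacent _ _ X) => //.
  by apply: contraTneq ij => ->; rewrite ltnn.
by apply/svec_neq0P; exists t; rewrite Xt.
Qed.

Lemma edge_prev i j0 : i \in S -> j0 \in S ->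
  index j0 s < index i s -> exists2 j, j \in S & edge j i.
Proof.
move=> iS j0S ij0; have [sg sg0 up] := on_envelope_exists iS.
have Vj0 : vopp (V i) j0 = Pos by rewrite voppE shelling_neg.
have [j [X [jS Vj XP Xt [Xi Xj]]]] := next_crossing sg0 iS up (or_intror erefl) j0S Vj0.
exists j => //; have ji : index j s < index i s.
  by rewrite -shelling_negE //; move: Vj; rewrite voppE; case: (V i j).
rewrite /shelling_edge !mem_shelling iS jS ji; apply: (@crossing_adjacent _ _ X) => //.
  by apply: contraTneq ji => ->; rewrite ltnn.
by apply/svec_neq0P; exists t; rewrite Xt.
Qed.

(** Repeating [envelope_next] leads from [i] to the last element [z]. *)
Lemma envelope_path sg i z : sg != Zero -> i \in S -> on_envelope sg i -> z \in S ->
  {in S, forall g, g != z -> index g s < index z s} ->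
  exists p, [/\ path edge i p, last i p = z & forall g, g \in p -> on_envelope sg g].
Proof.
move=> sg0 + + zS zmax.
elim: {i}(index z s - index i s) {-2}i (leqnn (index z s - index i s)) => [|n IHn] i.
  rewrite leqn0 subn_eq0 => zi iS _; exists [::]; split=> //=.
  by apply/eqP; apply: contraLR zi => iz; rewrite -ltnNge zmax.
move=> le_n iS up; have [-> | iz] := eqVneq i z; first by exists [::].
have [j [jS ij upj]] := envelope_next sg0 iS up zS (zmax i iS iz).
have ltij : index i s < index j s by case/and4P: ij.
have [|p [pp lp upp]] := IHn j _ jS upj.
  by rewrite -ltnS (leq_trans _ le_n) // ltn_sub2l // zmax.
exists (j :: p); split=> //=; first by rewrite ij.
by move=> g; rewrite inE => /orP[/eqP-> // | /upp].
Qed.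

(** The walks from the first to the last element on the two sides of the coline
    have no common inner vertex. *)
Lemma rank3_holt_klee : holt_klee S edge 2.
Proof.
have [a [aS VaP amin]] := shelling_first; have [z [zS zmax]] := shelling_last.
have lt_edge x y : edge x y -> index x s < index y s by case/and4P.
have path_uniq x p : path edge x p -> uniq (x :: p).
  move=> pp; apply: (@sorted_uniq _ (relpre (index^~ s) ltn)).
  - by move=> v u w /=; exact: ltn_trans.
  - by move=> u /=; exact: ltnn.
  by apply: sub_path pp => u v; exact: lt_edge.
exists a, z; split.
- move=> g; rewrite /is_source; have [-> | ga] := eqVneq g a.
    rewrite aS; apply/forall_inP=> y yS; apply/negP=> /lt_edge.
    have [-> | ya] := eqVneq y a; first by rewrite ltnn.
    by rewrite ltnNge ltnW // amin.
  apply/negP=> /andP[gS /forall_inP nE].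
  have [j jS jg] := edge_prev gS aS (amin g gS ga).
  by have := nE j jS; rewrite jg.
- move=> g; rewrite /is_sink; have [-> | gz] := eqVneq g z.
    rewrite zS; apply/forall_inP=> y yS; apply/negP=> /lt_edge.
    have [-> | yz] := eqVneq y z; first by rewrite ltnn.
    by rewrite ltnNge ltnW // zmax.
  apply/negP=> /andP[gS /forall_inP nE]; have [sg sg0 up] := on_envelope_exists gS.
  have [j [jS gj _]] := envelope_next sg0 gS up zS (zmax g gS gz).
  by have := nE j jS; rewrite gj.
have aenv sg : sg != Zero -> on_envelope sg a.
  by move=> sg0; apply: (on_envelope_end sg0 aS (or_introl erefl)).
have [p [pp lp up]] := envelope_path (isT : Pos != Zero) aS (aenv Pos isT) zS zmax.
have [q [pq lq uq]] := envelope_path (isT : Neg != Zero) aS (aenv Neg isT) zS zmax.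
have internalP r g : path edge a r -> last a r = z -> g \in internal a r ->
    [/\ g \in r, g \in S, g != a & g != z].
  case/lastP: r => [|r y] // pr; rewrite last_rcons => yz; subst y.
  rewrite /internal belast_rcons /= => gr.
  have ur := path_uniq _ _ pr.
  have grz : g \in rcons r z by rewrite mem_rcons inE gr orbT.
  split=> //.
  - have [r1 [r2 pr']] : exists r1 r2, rcons r z = r1 ++ g :: r2.
      by case/splitPr: grz => r1 r2; exists r1, r2.
    by move: pr; rewrite pr' cat_path /= => /and3P[_ /and4P[_ + _ _] _]; rewrite mem_shelling.
  - by apply: contraTneq ur => <-; rewrite /= grz.
  by move: ur; rewrite /= rcons_uniq => /and3P[_ zr _]; apply: contraNneq zr => <-.
have disj g : g \in internal a p -> g \in internal a q -> False.
  move=> /(internalP p g pp lp)[gp gS ga gz] /(internalP q g pq lq)[gq _ _ _].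
  apply: (inner_envelope_disjoint gS _ _ (up g gp) (uq g gq)).
    apply/negP=> /supercellP[_ /(_ a aS)].
    by rewrite shelling_neg // amin.
  apply/negP=> /supercellP[_ /(_ z zS)].
  by rewrite voppE shelling_pos // zmax.
exists (fun i : 'I_2 => if val i == 0 then p else q); split.
  by move=> i; case: ifP => _; rewrite /dipath ?pp ?pq ?lp ?lq !path_uniq ?eqxx.
move=> [[|[|//]] i2] [[|[|//]] j2] //= _ g.
  by move=> gp; apply/negP; exact: disj gp.
by move=> gq; apply/negP=> gp; exact: disj gp gq.
Qed.

End RankThree.

End Shelling.

(** * Rank at most three *)

Theorem proposition4 (U : finType) (M : oriented_matroid U)
    (rank_le3 : rank M <= 3) : HKstar M.
Proof.
move=> N NM T cT pT; split; first exact: coline_shelling_exists.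
move=> s ss; have [I [IT dI cI]] := coline_basis cT.
have := leq_trans (reorientation_minor_rank NM) rank_le3.
rewrite -cI addn2 !ltnS leq_eqVlt ltnS leqn0 => /orP[/cards1P[t It] | /eqP I0].
  rewrite It cards1; rewrite It in IT dI cI.
  apply: (@rank3_holt_klee _ _ _ _ cT pT ss _ t).
  - by rewrite -cI cards1.
  - by rewrite -sub1set.
  - move=> W WL Wt; apply: (basis_vanish cT IT dI cI WL) => a /set1P->.
    exact: Wt.
by rewrite I0; apply: rank2_holt_klee; rewrite // -cI I0.
Qed.
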